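(* For $\delta\in(0,1)$ put $c_0=1-\delta$, let $c_1\in\left(1-\delta,\frac{3-3\delta}{3-\delta}\right)$, let $P=\{x+yi\in\mathbb{C}:(x,y)\in\{-1,0,1\}^2\}$, and let $K$ be the conformal Cantor set with pieces $G(a)=\overline{S(a;c_0)}$, $a\in P$, all pairs in $P\times P$ admissible, and expanding map $g$ given on (a neighbourhood of) $G(a)$ by $g_a(z)=\frac{3}{c_1}(z-a)$. There is $\delta$ sufficiently small for which the pair of Cantor sets $(K,K)$ has a recurrent compact set of affine configurations of limit geometries $\mathcal{L}\subset\mathcal{C}$ such that $[\mathrm{Id},\mathrm{Id}]\in\mathcal{L}$.
   Context: $S(p;l)\subset\mathbb{C}$ is the open square centered at $p$ with sides of length $l$ parallel to the real and imaginary axes. $\mathrm{Aff}(\mathbb{C})$ is the group of maps $z\mapsto\alpha z+\beta$, $\alpha\in\mathbb{C}^*,\beta\in\mathbb{C}$. The Cantor set is $K=\bigcap_{n\ge0}g^{-n}\left(\bigsqcup_{a\in P}G(a)\right)$; the parameter $c_1$ is an arbitrary fixed number in the stated interval. **Limit geometries.** Let $\Sigma^-$ be the space of left-infinite sequences $\underline\theta=(\dots,\theta_{-1},\theta_0)$ in $P$ with the product topology. A finite word $\underline a=(a_0,\dots,a_n)$ in $P$ has size $n$, and $f_{\underline a}=g_{a_0}^{-1}\circ\cdots\circ g_{a_{n-1}}^{-1}$ on $G(a_n)$. If $a_0=\theta_0$, $\underline\theta\,\underline a=(\dots,\theta_{-1},a_0,\dots,a_n)$. Fix base points $c_a=a\in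 K\cap G(a)$. In general, the limit geometry $k^{\underline\theta}:G(\theta_0)\to\mathbb{C}$ is $\lim_n\Phi_{\underline\theta_n}\circ f_{\underline\theta_n}$, where $\underline\theta_n=(\theta_{-n},\dots,\theta_0)$ and $\Phi_{\underline\theta_n}\in\mathrm{Aff}(\mathbb{C})$ is chosen so that $\Phi_{\underline\theta_n}\circ f_{\underline\theta_n}$ sends $c_{\theta_0}$ to $0$ with derivative $1$ there; here, all maps being affine, $k^{\underline\theta}(z)=z-\theta_0$. $F^{\underline\theta\,\underline a}\in\mathrm{Aff}(\mathbb{C})$ is the map with $F^{\underline\theta\,\underline a}\circ k^{\underline\theta\,\underline a}=k^{\underline\theta}\circ f_{\underline a}$; for a word $(a,b)$ of size one with $a=\theta_0$ it is $F(z)=\frac{c_1}{3}(z+b)$. **Recurrent compact sets.** $\mathcal{C}$ is the quotient of $(\mathrm{Aff}(\mathbb{C})\times\Sigma^-)\times(\mathrm{Aff}(\mathbb{C})\times\Sigma^-)$ by the action $B\cdot((A,\underline\theta),(A',\underline\theta'))=((B\circ A,\underline\theta),(B\circ A',\underline\theta'))$ of $\mathrm{Aff}(\mathbb{C})$; $(A,\underline\theta)$ represents the affine configuration $A\circ k^{\underline\theta}$ of the piece $G(\theta_0)$. For words with $a_0=\theta_0$, $a'_0=\theta'_0$, the renormalization operator is $\mathcal{T}_{\underline a,\underline a'}[(A,\underline\theta),(A',\underline\theta')]=[(A\circ F^{\underline\theta\,\underline a},\underline\theta\,\underline a),(A'\circ F^{\underline\theta'\underline a'},\underline\theta'\underline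 a')]$; one of the words may be void (size $0$), the operator then being trivial on that coordinate. A compact set $\mathcal{L}\subset\mathcal{C}$ is recurrent if for every $v\in\mathcal{L}$ there are words $\underline a,\underline a'$, not both of size $0$, with $\mathcal{T}_{\underline a,\underline a'}(v)\in\mathrm{int}\,\mathcal{L}$. ''$[\mathrm{Id},\mathrm{Id}]\in\mathcal{L}$'' means that $\mathcal{L}$ contains the classes representing the pair of identity configurations of a same piece: for every $a\in P$ and all $\underline\theta,\underline\theta'\in\Sigma^-$ with $\theta_0=\theta'_0=a$, the class $[(\mathrm{Id},\underline\theta),(\mathrm{Id},\underline\theta')]$ (equal to $[(z\mapsto z+a,\underline\theta),(z\mapsto z+a,\underline\theta')]$, i.e. representing $[\mathrm{Id}_{G(a)},\mathrm{Id}_{G(a)}]$) lies in $\mathcal{L}$. *)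

(* Defs.v *)
From HB Require Import structures.
From mathcomp Require Import all_boot all_order all_algebra complex.
From mathcomp Require Import all_classical all_reals all_analysis.
Set Implicit Arguments.
Unset Strict Implicit.
Unset Printing Implicit Defensive.
Import Order.TTheory GRing.Theory Num.Theory.
Import numFieldNormedType.Exports.

Local Open Scope classical_set_scope.
Local Open Scope ring_scope.
Local Open Scope complex_scope.
Local Open Scope quotient_scope.

(* The complex plane as a normed module over itself: its topology is the usual
   one, and derivatives in the direction 1 are complex derivatives. *)
Notation Cplane R := (R[i]^o)%type.

(* The alphabet P, as a discrete space; [pt] embeds it in the plane, shifting
   each coordinate from {0, 1, 2} to {-1, 0, 1}. *)
Definition P := discrete_topology ('I_3 * 'I_3)%type.

Definition pt (R : realType) (a : P) : Cplane R :=
  (a.1%:R - 1) +i* (a.2%:R - 1).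

Section Cantor.
Variable R : realType.
Variables c0 c1 : R.

Definition square (p : Cplane R) (l : R) : set (Cplane R) :=
  [set z | `|complex.Re (z - p)| < l / 2 /\ `|complex.Im (z - p)| < l / 2].

Definition piece (a : P) : set (Cplane R) := closure (square (pt R a) c0).

Definition branch (a : P) (z : Cplane R) : Cplane R :=
  (3 / c1)%:C * (z - pt R a).

Definition branch_inv (a : P) (z : Cplane R) : Cplane R :=
  (c1 / 3)%:C * z + pt R a.

(* Outside the pieces, where the map is not defined, the value is a dummy. *)
Definition expanding (z : Cplane R) : Cplane R :=
  if [pick a : 'I_3 * 'I_3 | z \in piece a] is Some a then branch a z else z.

(* The dummy value above is harmless: the orbit of a point of [cantor] never
   leaves the pieces. *)
Definition cantor : set (Cplane R) :=
  [set z | forall n, exists a, piece a (iter n expanding z)].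

(* The word (a_0, ..., a_n) is encoded as (a_0, [:: a_1; ...; a_n]), so that
   its size n is the length of the second component. *)
Definition word := (P * seq P)%type.

Definition wsize (w : word) : nat := size w.2.
Definition wlast (w : word) : P := last w.1 w.2.

(* [belast a_0 [:: a_1; ...; a_n]] is [:: a_0; ...; a_(n-1)]. *)
Definition fword (w : word) (z : Cplane R) : Cplane R :=
  foldr branch_inv z (belast w.1 w.2).

(* [theta n] is the letter of index -n. *)
Definition Sigma := {ptws nat -> P}.

Definition trunc (theta : Sigma) (n : nat) : word :=
  (theta n, rev (mkseq theta n)).

(* Only meaningful if [w.1 = theta 0]: that letter is not duplicated. *)
Definition extend (theta : Sigma) (w : word) : Sigma :=
  fun n => if (n < wsize w)%N then nth w.1 (rev w.2) n
           else theta (n - wsize w)%N.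

(* The pair (alpha, beta) stands for z |-> alpha z + beta. *)
Definition Aff : topologicalType :=
  set_type [set p : Cplane R * Cplane R | p.1 != 0].

Definition aff (A : Aff) (z : Cplane R) : Cplane R :=
  (set_val A).1 * z + (set_val A).2.

Lemma aff_lin_neq0 (A : Aff) : (set_val A).1 != 0.
Proof. exact: (set_valP A). Qed.

Definition mkAff (alpha beta : Cplane R) (h : alpha != 0) : Aff :=
  exist _ (alpha, beta) (mem_set (h : [set p : Cplane R * Cplane R | p.1 != 0]
                                        (alpha, beta))).

Lemma mkAffE alpha beta (h : alpha != 0) z :
  aff (mkAff beta h) z = alpha * z + beta.
Proof. by []. Qed.

Lemma aff_inj (A B : Aff) : (forall z, aff A z = aff B z) -> A = B.
Proof.
move=> AB; apply/val_inj.
have E2 : (set_val A).2 = (set_val B).2.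
  by have := AB 0; rewrite /aff !mulr0 !add0r.
have E1 : (set_val A).1 = (set_val B).1.
  by have := AB 1; rewrite /aff E2 !mulr1 => /addIr.
move: E1 E2; rewrite !set_valE; case: (\val A) => a b; case: (\val B) => c d /=.
by move=> -> ->.
Qed.

Definition aff1 : Aff := mkAff 0 (oner_neq0 _).

Definition affM (A B : Aff) : Aff :=
  mkAff ((set_val A).1 * (set_val B).2 + (set_val A).2)
        (mulf_neq0 (aff_lin_neq0 A) (aff_lin_neq0 B)).

Definition affV (A : Aff) : Aff :=
  mkAff (- ((set_val A).1^-1 * (set_val A).2)) (invr_neq0 (aff_lin_neq0 A)).

Lemma aff1E z : aff aff1 z = z.
Proof. by rewrite mkAffE mul1r addr0. Qed.

Lemma affME A B z : aff (affM A B) z = aff A (aff B z).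
Proof. by rewrite mkAffE /aff mulrDr mulrA addrA. Qed.

Lemma aff1M A : affM aff1 A = A.
Proof. by apply: aff_inj => z; rewrite affME aff1E. Qed.

Lemma affMA A B D : affM A (affM B D) = affM (affM A B) D.
Proof. by apply: aff_inj => z; rewrite !affME. Qed.

Lemma affVM A : affM (affV A) A = aff1.
Proof.
apply: aff_inj => z; rewrite affME aff1E mkAffE /aff mulrDr mulrA.
by rewrite mulVf ?aff_lin_neq0// mul1r addrK.
Qed.

(* The affine map Phi such that Phi o h sends c to 0 with derivative 1. *)
Definition normalizer (h : Cplane R -> Cplane R) (c : Cplane R) : Aff :=
  xget aff1 [set Phi | aff Phi (h c) = 0 /\
                       is_derive c (1 : Cplane R) (aff Phi \o h) 1].

(* The base point of the piece of a is a itself. Only the values on the piece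
   of [theta 0] matter. *)
Definition limit_geometry (theta : Sigma) (z : Cplane R) : Cplane R :=
  lim (aff (normalizer (fword (trunc theta n)) (pt R (theta 0%N)))
           (fword (trunc theta n) z) @[n --> \oo]).

(* The affine map F with F o k^(theta w) = k^theta o f_w on the piece of the
   last letter of w. *)
Definition renorm_map (theta : Sigma) (w : word) : Aff :=
  xget aff1 [set F | forall z, piece (wlast w) z ->
    aff F (limit_geometry (extend theta w) z) =
    limit_geometry theta (fword w z)].

Definition preconfig : topologicalType := ((Aff * Sigma) * (Aff * Sigma))%type.

Definition act (B : Aff) (x : preconfig) : preconfig :=
  ((affM B x.1.1, x.1.2), (affM B x.2.1, x.2.2)).

Definition orbit_rel (x y : preconfig) : bool := `[< exists B, y = act B x >].

Lemma act1 x : act aff1 x = x.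
Proof. by case: x => [[A t] [A' t']]; rewrite /act /= !aff1M. Qed.

Lemma actM A B x : act A (act B x) = act (affM A B) x.
Proof. by rewrite /act /= !affMA. Qed.

Lemma orbit_rel_refl : reflexive orbit_rel.
Proof. by move=> x; apply/asboolP; exists aff1; rewrite act1. Qed.

Lemma orbit_rel_sym : symmetric orbit_rel.
Proof.
have S x y : orbit_rel x y -> orbit_rel y x.
  by move=> /asboolP[B ->]; apply/asboolP; exists (affV B);
     rewrite actM affVM act1.
by move=> x y; apply/idP/idP; exact: S.
Qed.

Lemma orbit_rel_trans : transitive orbit_rel.
Proof.
move=> y x z /asboolP[B ->] /asboolP[D ->].
by apply/asboolP; exists (affM D B); rewrite actM.
Qed.

Canonical orbit_equiv :=
  EquivRel orbit_rel orbit_rel_refl orbit_rel_sym orbit_rel_trans.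

Definition config : topologicalType :=
  quotient_topology {eq_quot orbit_equiv}.

Definition cls (x : preconfig) : config := \pi_({eq_quot orbit_equiv}) x.
Definition rep (v : config) : preconfig :=
  repr (v : {eq_quot orbit_equiv}).

Definition renorm_pre (w w' : word) (x : preconfig) : preconfig :=
  ((affM x.1.1 (renorm_map x.1.2 w), extend x.1.2 w),
   (affM x.2.1 (renorm_map x.2.2 w'), extend x.2.2 w')).

(* Independent of the representative, see [renorm_cls]. A void word is a word
   of size 0, on which the operator is trivial. *)
Definition renorm (w w' : word) (v : config) : config :=
  cls (renorm_pre w w' (rep v)).

(* The first letters agree with the letters of index 0; this too does not
   depend on the representative, see [compatible_cls]. *)
Definition compatible (w w' : word) (v : config) : Prop :=
  w.1 = (rep v).1.2 0%N /\ w'.1 = (rep v).2.2 0%N.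

Definition recurrent_compact (L : set config) : Prop :=
  compact L /\
  forall v, L v -> exists w w' : word,
    [/\ compatible w w' v, ~ (wsize w = 0%N /\ wsize w' = 0%N) &
        L° (renorm w w' v)].

Lemma clsP x y : cls x = cls y <-> exists B, y = act B x.
Proof.
rewrite /cls; split=> [/eqmodP/asboolP//|[B ->]].
by apply/eqmodP/asboolP; exists B.
Qed.

Lemma cls_rep v : cls (rep v) = v.
Proof. exact: reprK. Qed.

Lemma renorm_cls w w' x : renorm w w' (cls x) = cls (renorm_pre w w' x).
Proof.
apply/clsP; have [B xE] := (clsP (rep (cls x)) x).1 (cls_rep (cls x)).
by exists B; rewrite {1}xE /renorm_pre /act /= !affMA.
Qed.

Lemma compatible_cls w w' x : compatible w w' (cls x) <->
  w.1 = x.1.2 0%N /\ w'.1 = x.2.2 0%N.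
Proof.
have [B xE] := (clsP (rep (cls x)) x).1 (cls_rep (cls x)).
by rewrite /compatible {3 4}xE.
Qed.

Lemma branchK a : c1 != 0 -> cancel (branch a) (branch_inv a).
Proof.
move=> c1n0 z; rewrite /branch /branch_inv mulrA -rmorphM /=.
by rewrite mulrA divfK ?pnatr_eq0// divff// mul1r subrK.
Qed.

Lemma branch_invK a : c1 != 0 -> cancel (branch_inv a) (branch a).
Proof.
move=> c1n0 z; rewrite /branch /branch_inv addrK mulrA -rmorphM /=.
by rewrite mulrA divfK// divff ?pnatr_eq0// mul1r.
Qed.

Lemma fword_affine w z :
  fword w z = (c1 / 3)%:C ^+ wsize w * z + fword w 0.
Proof.
case: w => a s; rewrite /fword /wsize /=.
elim: s a => [|b s IH] a /=; first by rewrite expr0 mul1r addr0.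
by rewrite {1}/branch_inv IH {2}/branch_inv mulrDr mulrA -exprS addrA.
Qed.

Lemma is_derive_affine (alpha beta c : Cplane R) :
  is_derive c (1 : Cplane R) (fun z : Cplane R => alpha * z + beta) alpha.
Proof.
have -> : (fun z : Cplane R => alpha * z + beta) =
          (alpha \*: (id : Cplane R -> Cplane R)) \+ cst beta by [].
by apply: is_derive_eq; rewrite addr0 /GRing.scale /= mulr1.
Qed.

Lemma normalizerE (h : Cplane R -> Cplane R) (alpha beta c z : Cplane R) :
  alpha != 0 -> (forall x, h x = alpha * x + beta) ->
  aff (normalizer h c) (h z) = z - c.
Proof.
move=> an0 hE.
have comp B : aff B \o h = fun x : Cplane R =>
    ((set_val B).1 * alpha) * x + ((set_val B).1 * beta + (set_val B).2).
  by apply/funext => x; rewrite /aff /= hE mulrDr mulrA addrA.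
have [] : [set Phi | aff Phi (h c) = 0 /\
    is_derive c (1 : Cplane R) (aff Phi \o h) 1] (normalizer h c).
  apply: xgetPex.
  exists (mkAff (- (c + alpha^-1 * beta)) (invr_neq0 an0)); split.
    by rewrite mkAffE hE mulrDr mulrA mulVf// mul1r subrr.
  rewrite comp /=.
  exact: (@is_derive_eq _ _ _ _ _ _ _ _ (is_derive_affine _ _ _) (mulVf an0)).
move: (normalizer h c) => B Bc; rewrite comp => dB.
have Ba : (set_val B).1 * alpha = 1.
  have D := @derive_val _ _ _ _ _ _ _ (is_derive_affine
    ((set_val B).1 * alpha) ((set_val B).1 * beta + (set_val B).2) c).
  by rewrite -D; apply: derive_val.
have E x : aff B (h x) = x + ((set_val B).1 * beta + (set_val B).2).
  by rewrite -[LHS]/((aff B \o h) x) comp Ba mul1r.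
by rewrite -[LHS]subr0 -Bc !E opprD addrACA subrr addr0.
Qed.

Lemma limit_geometryE theta z :
  c1 != 0 -> limit_geometry theta z = z - pt R (theta 0%N).
Proof.
move=> c1n0; rewrite /limit_geometry.
under eq_fun => n.
  rewrite (normalizerE _ _ _ (fword_affine (trunc theta n))); last first.
    rewrite expf_neq0// fmorph_eq0 mulf_neq0// invr_eq0 pnatr_eq0//.
  over.
exact: lim_cst.
Qed.

Lemma extend0 theta w :
  w.1 = theta 0%N -> extend theta w 0%N = wlast w.
Proof.
case: w => a s /= a0; rewrite /extend /wsize /wlast /=.
case: s => [|b s] /=; first by rewrite -a0.
by rewrite nth_rev//= subn1 -last_nth.
Qed.

Lemma squareE p l z : square p l z <->
  `|complex.Re z - complex.Re p| < l / 2 /\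
  `|complex.Im z - complex.Im p| < l / 2.
Proof. by case: z p => [x y] [x' y']. Qed.

Lemma pt_square a : 0 < c0 -> square (pt R a) c0 (pt R a).
Proof. by move=> c0p; apply/squareE; rewrite !subrr normr0 divr_gt0. Qed.

Lemma piece_pt a : 0 < c0 -> piece a (pt R a).
Proof. by move=> c0p; apply: subset_closure; exact: pt_square. Qed.

Lemma renorm_mapE theta w z : 0 < c0 -> c1 != 0 -> w.1 = theta 0%N ->
  aff (renorm_map theta w) z =
  (c1 / 3)%:C ^+ wsize w * z + (fword w (pt R (wlast w)) - pt R (theta 0%N)).
Proof.
move=> c0p c1n0 w0; set a := wlast w.
have ln0 : (c1 / 3)%:C ^+ wsize w != 0 :> Cplane R.
  by rewrite expf_neq0// fmorph_eq0 mulf_neq0// invr_eq0 pnatr_eq0.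
pose F := mkAff (fword w (pt R a) - pt R (theta 0%N)) ln0.
have FE y : aff F (limit_geometry (extend theta w) y) =
            limit_geometry theta (fword w y).
  rewrite !limit_geometryE// extend0// mkAffE -/a.
  rewrite [fword w y]fword_affine [fword w (pt R a)]fword_affine.
  by rewrite mulrBr addrA addrA subrK.
have GF : [set F | forall z, piece (wlast w) z ->
    aff F (limit_geometry (extend theta w) z) =
    limit_geometry theta (fword w z)] (renorm_map theta w).
  by apply: xgetPex; exists F => y _.
have key y : piece a y ->
    aff (renorm_map theta w) (y - pt R a) = aff F (y - pt R a).
  by move=> ay; have := GF y ay; rewrite -FE limit_geometryE// extend0.
suff -> : renorm_map theta w = F by rewrite mkAffE.
have := key _ (@piece_pt a c0p); rewrite subrr /aff !mulr0 !add0r => E2.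
have ay : piece a (pt R a + (c0 / 4)%:C).
  apply: subset_closure; apply/squareE => /=.
  have c4 : 0 < c0 / 4 by rewrite divr_gt0.
  rewrite [_ + c0 / 4 - _]addrAC addr0 !subrr add0r normr0 divr_gt0// gtr0_norm//.
  by rewrite ltr_pM2l// ltf_pV2 ?posrE// ltr_nat.
have := key _ ay; rewrite [pt R a + _]addrC addrK /aff E2 => /addIr /mulIf E1.
apply: aff_inj => y; rewrite /aff E2 E1//.
by rewrite fmorph_eq0 mulf_neq0 ?gt_eqF// invr_gt0.
Qed.

Lemma renorm_map1E theta (a b : P) z : 0 < c0 -> c1 != 0 -> a = theta 0%N ->
  aff (renorm_map theta (a, [:: b])) z = (c1 / 3)%:C * (z + pt R b).
Proof.
move=> c0p c1n0 a0; rewrite renorm_mapE//= /fword /wsize /wlast /= expr1.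
by rewrite /branch_inv -a0 addrK mulrDr.
Qed.

Lemma normc_ge_Im (z : R[i]) : `|complex.Im z|%:C <= `|z|.
Proof.
by case: z => u v; simpc; rewrite -sqrtr_sqr ler_wsqrtr// lerDr sqr_ge0.
Qed.

Lemma piece_pt_inj a b : c0 < 1 -> piece b (pt R a) -> a = b.
Proof.
move=> c01 /(_ _ (nbhsx_ballx _ ((1 / 2)%:C : R[i]) _))[|y [/squareE[yb yb']]].
  by rewrite ltcR divr_gt0.
rewrite -ball_normE /= => ya.
have coord (i j : 'I_3) (u : R) : `|u - (j%:R - 1)| < c0 / 2 ->
    `|i%:R - 1 - u| < 1 / 2 -> i = j.
  move=> uj iu; have : `|i%:R - j%:R : R| < 1.
    have -> : i%:R - j%:R = (i%:R - 1 - u) + (u - (j%:R - 1)) :> R.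
      by rewrite addrA subrK opprB addrA subrK.
    apply: (le_lt_trans (ler_normD _ _)).
    rewrite [ltRHS](splitr 1) ltrD//; apply: (lt_trans uj).
    by rewrite ltr_pM2r// invr_gt0.
  move=> ij; apply/val_inj => /=; apply/eqP.
  rewrite eqn_leq; apply/andP; split; rewrite leqNgt; apply/negP => lt.
    move: ij; rewrite -natrB 1?ltnW// normr_nat -[1]/(1%:R) ltr_nat.
    by rewrite ltnS leqn0 subn_eq0 leqNgt lt.
  move: ij; rewrite distrC -natrB 1?ltnW// normr_nat -[1]/(1%:R) ltr_nat.
  by rewrite ltnS leqn0 subn_eq0 leqNgt lt.
have re := le_lt_trans (normc_ge_Re _) ya.
have im := le_lt_trans (normc_ge_Im _) ya.
move: re im yb yb'; rewrite !ltcR {ya}; case: y => [u v] /= re im yb yb'.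
case: a b re im yb yb' => [a a'] [b b'] /= re im yb yb'.
by rewrite (coord _ _ _ yb re) (coord _ _ _ yb' im).
Qed.

Lemma pt_cantor a : 0 < c0 -> c0 < 1 -> cantor (pt R a).
Proof.
move=> c0p c01 n.
suff [b ->] : exists b, iter n expanding (pt R a) = pt R b.
  by exists b; exact: piece_pt.
elim: n => [|n [b IH]]; first by exists a.
pose o := Ordinal (isT : (1 < 3)%N).
exists ((o, o) : P); rewrite iterS IH /expanding.
case: pickP => [d|/(_ b)]; last by rewrite mem_set//; exact: piece_pt.
move=> /set_mem /(piece_pt_inj c01) <-.
by rewrite /branch subrr mulr0 /pt /= subrr.
Qed.

End Cantor.

(* Main.v *)
Require Import Defs.
From mathcomp Require Import all_boot all_order all_algebra complex.
From mathcomp Require Import all_classical all_reals all_analysis.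
From mathcomp Require Import ring lra.
Import Order.TTheory GRing.Theory Num.Theory.
Import numFieldNormedType.Exports.
Local Open Scope classical_set_scope.
Local Open Scope ring_scope.

(** All maps being affine, the class of [(A, theta), (A', theta')] is determined
by [theta], [theta'] and the relative position [A^-1 o A' : z |-> s z + t],
with [s] in C^* and [t] in C.  Put [lambda = c1 / 3], slightly less than 1/3.
Adding a letter [b] to the first word and [b'] to the second one replaces
[(s, t)] by [(s, t / lambda + s b' - b)]; adding letters to one word only
multiplies [s] by a power of [lambda].  The letters never depend on [theta], so
the recurrent set is sought as the set of all classes with [(s, t)] in a fixed
compact set.  As the argument of [s] never changes, a set of [s] confined to a
sector is never carried into its interior; so all arguments are allowed, and the
set is a full square annulus in [s], of ratio larger than 1/lambda, times one
square in [t], independent of [s]: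
[1/10 <= |s| <= 21/20] and [|t| <= 101/200] for the sup norm of the plane.

The square for [t] has side slightly larger than 1, the mesh of the grid of
letters.  The point [t / lambda] lies in a square of side about 3.03, while
translates of the unit square by the nine letters [b] only cover a square of
side 3.  The missing frame is reached with [b']: for each [s] there is a letter
[b'] such that both coordinates of [s b'] are at least [|s| / 3], and, rotating
[b'] by quarter turns, the direction of [s b'] can be chosen to point from
[t / lambda] towards the origin in both coordinates ([steer]).  Then rounding to
the nearest letter [b] leaves a point with [|t| <= 1/2] ([renormalize_shift]),
well inside the square.

It remains to move [s] off the boundary of the annulus: one extra letter on the
first word when [|s| < 1/3] ([enlarge]), one extra letter on the second word
otherwise ([shrink]).  The inequalities leave enough room for delta = 1/1000.
Compactness holds because every class has a representative whose first map is
the identity, so that the set is a continuous image of a product of compact sets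
with two copies of the Cantor set of sequences; the strict inequalities define
an open set because the relative position is continuous and constant on
orbits. *)

Set Implicit Arguments.
Unset Strict Implicit.
Unset Printing Implicit Defensive.

(** * The sup norm of the plane *)

Section SupNorm.
Variable R : realType.
Implicit Types (z w : Cplane R) (k r : R).

(** The pieces are squares with sides parallel to the axes: they are the balls
of this norm. *)
Definition supn z : R := Num.max `|complex.Re z| `|complex.Im z|.

Lemma supn_le z r :
  (supn z <= r) = (`|complex.Re z| <= r) && (`|complex.Im z| <= r).
Proof. exact: ge_max. Qed.

Lemma supn_ge0 z : 0 <= supn z.
Proof. by rewrite le_max normr_ge0. Qed.

Lemma supnZ k z : 0 <= k -> supn (k%:C%C * z) = k * supn z.
Proof.
move=> k0; case: z => x y; rewrite /supn /= !mul0r subr0 addr0 !normrM.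
by rewrite (ger0_norm k0) maxr_pMr.
Qed.

Lemma supn_lipschitz z w : `|supn z - supn w|%:C%C <= `|z - w|.
Proof.
have re := normc_ge_Re (z - w); have im := normc_ge_Im (z - w).
have dist (a b r : R) : `|a - b| <= r -> - r <= `|a| - `|b| <= r.
  by rewrite -ler_norml; apply: le_trans; exact: ler_dist_dist.
have [m [mle rem imm]] : exists m, [/\ m%:C%C <= `|z - w|,
    `|complex.Re z - complex.Re w| <= m & `|complex.Im z - complex.Im w| <= m].
  move: re im; case: (z) => [a b]; case: (w) => [c d] /= re im.
  case: (leP `|a - c| `|b - d|) => h; first by exists `|b - d|.
  by exists `|a - c|; split=> //; exact: ltW.
apply: le_trans mle; rewrite lecR ler_norml /supn.
have := dist _ _ _ rem; have := dist _ _ _ imm.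
case: (leP `|complex.Re z| `|complex.Im z|) => ?;
case: (leP `|complex.Re w| `|complex.Im w|) => ?; lra.
Qed.

Lemma supn_continuous : continuous (supn : Cplane R -> R).
Proof.
move=> z; apply/(@cvgrPdist_le _ R^o _ _ (nbhs_filter z)) => e e0.
have e0' : 0 < e%:C%C by rewrite ltcR.
near=> w.
have /(le_trans (supn_lipschitz _ _)) : `|z - w| <= e%:C%C.
  near: w.
  exact: (@cvgr_dist_le _ (Cplane R) _ _ (nbhs_filter z) id z (@cvg_id _ _)).
by rewrite lecR.
Unshelve. all: by end_near.
Qed.

(** The ball is the image of a real rectangle. *)
Lemma compact_supn_le (r : R) : compact [set z : Cplane R | supn z <= r].
Proof.
have -> : [set z : Cplane R | supn z <= r] =
  (fun p : R^o * R^o => (p.1 +i* p.2)%C : Cplane R) @` (`[-r, r] `*` `[-r, r]).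
  apply/seteqP; split=> [ [x y]|z [ [x y] [] ] ] /=.
    rewrite supn_le => /= /andP[xr yr]; exists (x, y) => //=.
    by rewrite !in_itv/= -!ler_norml.
  by rewrite !in_itv /= => xr yr <-; rewrite supn_le !ler_norml /= xr yr.
apply: continuous_compact; last first.
  by apply: compact_setX; exact: segment_compact.
apply: continuous_subspaceT => p.
apply/(@cvgrPdist_le _ (Cplane R) _ _ (nbhs_filter p)) => e e0.
have ee : e = (complex.Re e)%:C%C by rewrite RRe_real// gtr0_real.
have re0 : 0 < complex.Re e by rewrite -ltcR -ee.
have re2 : 0 < complex.Re e / 2 by rewrite divr_gt0.
near=> w.
have hx : `|p.1 - w.1| <= complex.Re e / 2.
  near: w.
  exact: (@cvgr_dist_le _ R^o _ _ (nbhs_filter p) fst p.1 cvg_fst _ re2).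
have hy : `|p.2 - w.2| <= complex.Re e / 2.
  near: w.
  exact: (@cvgr_dist_le _ R^o _ _ (nbhs_filter p) snd p.2 cvg_snd _ re2).
rewrite ee normc_def lecR /= -[leRHS]gtr0_norm// -sqrtr_sqr.
apply: ler_wsqrtr; move: hx hy; rewrite !ler_norml => hx hy.
nra.
Unshelve. all: by end_near. Qed.

End SupNorm.

(** * Choosing the letters *)

Section Letters.
Variable R : realType.
Implicit Types (s z w : Cplane R).

Lemma nearest_coordinate (x e : R) : 0 <= e -> `|x| <= 3 / 2 + e ->
  exists i : 'I_3, `|x - (i%:R - 1)| <= 1 / 2 + e.
Proof.
move=> e0; rewrite ler_norml => /andP[xl xr].
have [h|h] := leP x (- (1 / 2)).
  by exists ord0; rewrite /= ler_norml; lra.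
have [h'|h'] := leP x (1 / 2).
  by exists (inord 1); rewrite inordK//= ler_norml; lra.
by exists (inord 2); rewrite inordK//= ler_norml; lra.
Qed.

Lemma nearest_letter z (e : R) : 0 <= e -> supn z <= 3 / 2 + e ->
  exists b, supn (z - pt R b) <= 1 / 2 + e.
Proof.
move=> e0; rewrite supn_le => /andP[].
move=> /(nearest_coordinate e0)[i ri] /(nearest_coordinate e0)[j rj].
by exists (i, j); rewrite supn_le; move: ri rj; case: z => x y /= -> ->.
Qed.

Lemma quarter_turn (b : P) : exists b', pt R b' = 'i%C * pt R b.
Proof.
case: b => i j; exists (rev_ord j, i).
rewrite /pt /=; simpc; congr (_ +i* _)%C.
by rewrite natrB ?subSS//= -1?ltnS//; lra.
Qed.

Lemma mul_quarter_turn s w :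
  complex.Re (s * ('i%C * w)) = - complex.Im (s * w) /\
  complex.Im (s * ('i%C * w)) = complex.Re (s * w).
Proof. by case: s w => [x y] [u v] /=; split; ring. Qed.

(** If [s] itself is too close to an axis, [(1 + i) s] is close to a diagonal. *)
Lemma away_from_axes s : exists b,
  [/\ supn s / 3 <= `|complex.Re (s * pt R b)|,
      supn s / 3 <= `|complex.Im (s * pt R b)| &
      supn (s * pt R b) <= 4 / 3 * supn s].
Proof.
pose d k : 'I_3 := inord k.
have E k : (k < 3)%N -> (d k : nat) = k by move=> ?; rewrite inordK.
case: s => x y.
have [h|h] := boolP ((supn (x +i* y)%C / 3 <= `|x|) &&
                     (supn (x +i* y)%C / 3 <= `|y|)).
  (* the letter 1 *)
  exists (d 2, d 1); move: h; rewrite supn_le /pt /= !E// /supn /=.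
  rewrite (_ : x * _ - y * _ = x); last by ring.
  rewrite (_ : x * _ + y * _ = y); last by ring.
  case/andP=> -> ->; split=> //; case: (leP `|x| `|y|) => ?;
  have := normr_ge0 x; have := normr_ge0 y; lra.
(* the letter 1 + i *)
exists (d 2, d 2); move: h; rewrite supn_le /pt /= !E// /supn /=.
rewrite (_ : x * _ - y * _ = x - y); last by ring.
rewrite (_ : x * _ + y * _ = x + y); last by ring.
rewrite negb_and -!ltNge => /orP[]; case: (leP `|x| `|y|);
case: (ger0P x) => hx; case: (ger0P y) => hy;
case: (ger0P (x - y)) => hd; case: (ger0P (x + y)) => hs h1 h2; split; lra.
Qed.

Lemma first_quadrant s : exists b,
  (supn s / 3 <= complex.Re (s * pt R b) <= 4 / 3 * supn s) &&
  (supn s / 3 <= complex.Im (s * pt R b) <= 4 / 3 * supn s).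
Proof.
have [b0 [re im]] := away_from_axes s; rewrite supn_le => /andP[].
move: re im.
have [b1 E1] := quarter_turn b0; have [R1 I1] := mul_quarter_turn s (pt R b0).
have [b2 E2] := quarter_turn b1; have [R2 I2] := mul_quarter_turn s (pt R b1).
have [b3 E3] := quarter_turn b2; have [R3 I3] := mul_quarter_turn s (pt R b2).
case: (ger0P (complex.Re (s * pt R b0))) => hx;
case: (ger0P (complex.Im (s * pt R b0))) => hy h1 h2 h3 h4;
 [exists b0 | exists b1 | exists b3 | exists b2];
 rewrite ?E3 ?R3 ?I3 ?E2 ?R2 ?I2 ?E1 ?R1 ?I1; lra.
Qed.

(** Among the four quarter turns of the letter given by [first_quadrant], one
pushes both coordinates of [z] towards the origin; the bound on [s] prevents
the translation from overshooting. *)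
Lemma steer s z : supn s <= 9 / 8 -> supn z <= 3 / 2 + supn s / 3 ->
  exists b, supn (z + s * pt R b) <= 3 / 2.
Proof.
move=> s1; rewrite supn_le => /andP[].
have [b0 /andP[/andP[re1 re2] /andP[im1 im2]]] := first_quadrant s.
have [b1 E1] := quarter_turn b0; have [R1 I1] := mul_quarter_turn s (pt R b0).
have [b2 E2] := quarter_turn b1; have [R2 I2] := mul_quarter_turn s (pt R b1).
have [b3 E3] := quarter_turn b2; have [R3 I3] := mul_quarter_turn s (pt R b2).
rewrite !ler_norml => /andP[h1 h2] /andP[h3 h4].
have add w : supn (z + w) <= 3 / 2 =
  (- (3 / 2) <= complex.Re z + complex.Re w <= 3 / 2) &&
  (- (3 / 2) <= complex.Im z + complex.Im w <= 3 / 2).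
  by rewrite supn_le !ler_norml; case: (z) (w) => [? ?] [? ?].
case: (lerP 0 (complex.Re z)) => hx;
case: (lerP 0 (complex.Im z)) => hy;
 [exists b2 | exists b1 | exists b3 | exists b0];
 rewrite add ?E3 ?R3 ?I3 ?E2 ?R2 ?I2 ?E1 ?R1 ?I1; lra.
Qed.

End Letters.

(** * Recurrence of the relative position *)

(** In this part [k] is the expansion factor [3 / c1]; the bound 1001/333
exceeds the value 1000/333 that corresponds to [c1 = 999/1000]. *)

Section Moves.
Variable R : realType.
Implicit Types (s t : Cplane R) (k : R).

(** The numerical heart: [k |t|] is at most 1.52 while [steer] allows
3/2 + 1/30. *)
Lemma renormalize_shift s t k : 3 <= k <= 1001 / 333 ->
  1 / 10 <= supn s <= 9 / 8 -> supn t <= 101 / 200 ->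
  exists b b', supn (k%:C%C * t + s * pt R b' - pt R b) <= 1 / 2.
Proof.
move=> /andP[k3 k4] /andP[s1 s2] t1.
have [|b' hb'] := @steer R s (k%:C%C * t) s2.
  rewrite supnZ; last by lra.
  have := supn_ge0 t; nra.
have [|b hb] := nearest_letter (lexx 0) (le_trans hb' _).
  by rewrite addr0.
by exists b, b'; move: hb; rewrite addr0.
Qed.

(** The extra letter [b1] of the first word comes after the simultaneous
renormalization, when [|t| <= 1/2]: then one letter is enough to bring back
[k t], of norm at most 3/2 + 1/300, without any help from the second word. *)
Lemma enlarge s t k : 3 <= k <= 1001 / 333 -> 1 / 10 <= supn s < 1 / 3 ->
  supn t <= 101 / 200 ->
  exists b0 b1 b', 1 / 10 < supn (k%:C%C * s) < 21 / 20 /\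
   supn (k%:C%C * (k%:C%C * t + s * pt R b' - pt R b0) - pt R b1) < 101 / 200.
Proof.
move=> kb /andP[s1 s2] t1; move/andP: (kb) => [k3 k4].
have sb : 1 / 10 <= supn s <= 9 / 8 by apply/andP; split; lra.
have [b0 [b' h]] := renormalize_shift kb sb t1.
have e0 : 0 <= 1 / 300 :> R by lra.
have kt : supn (k%:C%C * (k%:C%C * t + s * pt R b' - pt R b0)) <= 3 / 2 + 1 / 300.
  by rewrite supnZ; [apply: le_trans (ler_wpM2l _ h) _; lra|lra].
have [b1 h1] := nearest_letter e0 kt.
exists b0, b1, b'; split; last by apply: le_lt_trans h1 _; lra.
rewrite supnZ; last by lra.
by move: (supn s) s1 s2 => S s1 s2; apply/andP; split; nra.
Qed.

(** Here the contraction of [s] comes first; it leaves [t] unchanged when the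
extra letter of the second word is 0. *)
Lemma shrink s t k : 3 <= k <= 1001 / 333 -> 1 / 3 <= supn s <= 21 / 20 ->
  supn t <= 101 / 200 ->
  exists b b', 1 / 10 < supn (k^-1%:C%C * s) < 21 / 20 /\
   supn (k%:C%C * t + (k^-1%:C%C * s) * pt R b' - pt R b) < 101 / 200.
Proof.
move=> kb /andP[s1 s2] t1; move/andP: (kb) => [k3 k4].
have k0 : 0 < k by lra.
have kV : 333 / 1001 <= k^-1 <= 1 / 3.
  have l0 : 0 < k^-1 by rewrite invr_gt0.
  have kk : k^-1 * k = 1 by rewrite mulVf// gt_eqF.
  by move: (k^-1) l0 kk => l l0 kk; apply/andP; split; nra.
have kV0 : 0 <= k^-1 by lra.
have sk : 1 / 10 < supn (k^-1%:C%C * s) < 21 / 20.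
  rewrite supnZ//; move: (k^-1) (supn s) kV s1 s2 => l S /andP[? ?] ? ?.
  by apply/andP; split; nra.
have sb : 1 / 10 <= supn (k^-1%:C%C * s) <= 9 / 8.
  by move/andP: sk => [? ?]; apply/andP; split; lra.
have [b [b' h]] := renormalize_shift kb sb t1.
by exists b, b'; split=> //; apply: le_lt_trans h _; lra.
Qed.

End Moves.

Section RelativePosition.
Variable R : realType.
Implicit Types (x y : preconfig R) (A B : Aff R).

Definition lin A : Cplane R := (set_val A).1.
Definition trans A : Cplane R := (set_val A).2.

(** [A^-1 o A'] is the map [z |-> relscale * z + relshift]. *)
Definition relscale x : Cplane R := (lin x.1.1)^-1 * lin x.2.1.
Definition relshift x : Cplane R :=
  (lin x.1.1)^-1 * (trans x.2.1 - trans x.1.1).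

Lemma linM A B : lin (affM A B) = lin A * lin B.
Proof. by []. Qed.

Lemma transM A B : trans (affM A B) = lin A * trans B + trans A.
Proof. by []. Qed.

Lemma lin_neq0 A : lin A != 0.
Proof. exact: aff_lin_neq0. Qed.

Lemma lin1 : lin (aff1 R) = 1.
Proof. by rewrite /lin set_valE. Qed.

Lemma trans1 : trans (aff1 R) = 0.
Proof. by rewrite /trans set_valE. Qed.

Lemma relscale_act B x : relscale (act B x) = relscale x.
Proof.
by rewrite /relscale /act /= !linM invfM mulrACA mulVf ?lin_neq0// mul1r.
Qed.

Lemma relshift_act B x : relshift (act B x) = relshift x.
Proof.
rewrite /relshift /act /= linM !transM.
have := lin_neq0 B; have := lin_neq0 x.1.1.
by move: (lin x.1.1) (lin B) => a b a0 b0; field; rewrite a0 b0.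
Qed.

Lemma relscale_id (th th' : Sigma) A :
  relscale ((aff1 R, th), (A, th')) = lin A.
Proof. by rewrite /relscale lin1 invr1 mul1r. Qed.

Lemma relshift_id (th th' : Sigma) A :
  relshift ((aff1 R, th), (A, th')) = trans A.
Proof. by rewrite /relshift lin1 trans1 invr1 mul1r subr0. Qed.

End RelativePosition.

Section Renormalization.
Variables (R : realType) (c0 c1 : R).
Hypotheses (c0_gt0 : 0 < c0) (c1_neq0 : c1 != 0).
Implicit Types (th : Sigma) (w : word) (x : preconfig R).
Let lam : Cplane R := (c1 / 3)%:C%C.

Let lam_neq0 : lam != 0.
Proof. by rewrite fmorph_eq0 mulf_neq0// invr_eq0 pnatr_eq0. Qed.

Lemma lin_renorm_map th w : w.1 = th 0%N ->
  lin (renorm_map c0 c1 th w) = lam ^+ wsize w.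
Proof.
move=> w0; have E z := @renorm_mapE R c0 c1 th w z c0_gt0 c1_neq0 w0.
have := E 1; have := E 0; rewrite /aff /lin !mulr0 !add0r !mulr1 => ->.
exact: addIr.
Qed.

Lemma trans_renorm_map th w : w.1 = th 0%N ->
  trans (renorm_map c0 c1 th w) = fword c1 w (pt R (wlast w)) - pt R (th 0%N).
Proof.
move=> w0; have E z := @renorm_mapE R c0 c1 th w z c0_gt0 c1_neq0 w0.
by have := E 0; rewrite /aff /trans !mulr0 !add0r.
Qed.

Lemma relscale_renorm w w' x : w.1 = x.1.2 0%N -> w'.1 = x.2.2 0%N ->
  relscale (renorm_pre c0 c1 w w' x) =
  relscale x * lam ^+ wsize w' / lam ^+ wsize w.
Proof.
move=> w0 w0'; rewrite /relscale /renorm_pre /= !linM !lin_renorm_map//.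
have := lin_neq0 x.1.1.
move: (lin x.1.1) (lin x.2.1) (expf_neq0 (wsize w) lam_neq0) => a b h ha.
by field; rewrite h ha.
Qed.

Lemma relshift_renorm w w' x : w.1 = x.1.2 0%N -> w'.1 = x.2.2 0%N ->
  relshift (renorm_pre c0 c1 w w' x) =
  (relscale x * trans (renorm_map c0 c1 x.2.2 w') + relshift x
    - trans (renorm_map c0 c1 x.1.2 w)) / lam ^+ wsize w.
Proof.
move=> w0 w0'.
rewrite /relshift /relscale /renorm_pre /= !linM !transM !lin_renorm_map//.
have := lin_neq0 x.1.1.
move: (lin x.1.1) (expf_neq0 (wsize w) lam_neq0) => a h ha.
by field; rewrite h ha.
Qed.

Lemma trans_renorm_map1 th b :
  trans (renorm_map c0 c1 th (th 0%N, [:: b])) = lam * pt R b.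
Proof. by rewrite trans_renorm_map// /fword /= /branch_inv addrK. Qed.

Lemma trans_renorm_map2 th b d :
  trans (renorm_map c0 c1 th (th 0%N, [:: b; d])) =
  lam * (lam * pt R d + pt R b).
Proof. by rewrite trans_renorm_map// /fword /= /branch_inv addrK. Qed.

(** Transcription of [enlarge] and [shrink] into words of sizes (2, 1) and
(1, 2). *)
Lemma recurrence x : 3 <= 3 / c1 <= 1001 / 333 ->
  1 / 10 <= supn (relscale x) <= 21 / 20 ->
  supn (relshift x) <= 101 / 200 ->
  exists w w', [/\ w.1 = x.1.2 0%N, w'.1 = x.2.2 0%N,
    ~ (wsize w = 0%N /\ wsize w' = 0%N),
    1 / 10 < supn (relscale (renorm_pre c0 c1 w w' x)) < 21 / 20 &
    supn (relshift (renorm_pre c0 c1 w w' x)) < 101 / 200].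
Proof.
move=> kb /andP[s1 s2] t1; set k := 3 / c1 in kb.
have lamV : k%:C%C = lam^-1 :> Cplane R.
  by rewrite /lam -fmorphV /k invf_div.
have kV : k^-1%:C%C = lam :> Cplane R by rewrite /k invf_div.
have [z0 pt_z0] : exists z0, pt R z0 = 0.
  by exists (inord 1, inord 1); rewrite /pt /= inordK// subrr.
have [small|large] := ltP (supn (relscale x)) (1 / 3).
  have sb : 1 / 10 <= supn (relscale x) < 1 / 3 by rewrite s1 small.
  have [b0 [b1 [b' [hs ht]]]] := enlarge kb sb t1.
  exists (x.1.2 0%N, [:: b0; b1]), (x.2.2 0%N, [:: b']).
  have s'E : relscale x * lam ^+ 1 / lam ^+ 2 = lam^-1 * relscale x.
    by move: (lam) lam_neq0 => l l0; field.
  have t'E : (relscale x * (lam * pt R b') + relshift x -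
      lam * (lam * pt R b1 + pt R b0)) / lam ^+ 2 =
      lam^-1 * (lam^-1 * relshift x + relscale x * pt R b' - pt R b0)
      - pt R b1.
    by move: (lam) lam_neq0 => l l0; field.
  rewrite relscale_renorm; [|by []|by []].
  rewrite relshift_renorm; [|by []|by []].
  rewrite trans_renorm_map1 trans_renorm_map2.
  by rewrite /wsize /= s'E t'E -lamV; split=> // -[].
have sb : 1 / 3 <= supn (relscale x) <= 21 / 20 by rewrite large s2.
have [b [b' [hs ht]]] := shrink kb sb t1.
exists (x.1.2 0%N, [:: b]), (x.2.2 0%N, [:: z0; b']).
have s'E : relscale x * lam ^+ 2 / lam ^+ 1 = lam * relscale x.
  by move: (lam) lam_neq0 => l l0; field.
have t'E : (relscale x * (lam * (lam * pt R b' + pt R z0)) + relshift x -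
    lam * pt R b) / lam ^+ 1 =
    lam^-1 * relshift x + lam * relscale x * pt R b' - pt R b.
  by rewrite pt_z0; move: (lam) lam_neq0 => l l0; field.
rewrite relscale_renorm; [|by []|by []].
rewrite relshift_renorm; [|by []|by []].
rewrite trans_renorm_map2 trans_renorm_map1.
by rewrite /wsize /= s'E t'E -lamV -kV; split=> // -[].
Qed.

End Renormalization.

(** * Topology of the space of configurations *)

Section Topology.

Lemma compact_set_type (X : topologicalType) (A K : set X) :
  K `<=` A -> compact K -> compact (set_val @^-1` K : set (set_type A)).
Proof.
move=> KA cK F PF FK.
have [p [Kp clp]] := cK (set_val @ F) _ FK.
exists (exist _ p (mem_set (KA _ Kp)) : set_type A); split => //.
move=> B D FB [D0 [[U oU <-] Up UD]].
have nU : nbhs p U by apply: open_nbhs_nbhs; split.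
have FVB : (set_val @ F) (set_val @` B).
  exact: filterS (@preimage_image _ _ set_val B) FB.
have [y [[x Bx <-] Ux]] := clp _ _ FVB nU.
by exists x; split=> //; exact: UD.
Qed.

Lemma compact_Sigma : compact [set: Sigma].
Proof.
have finP : finite_set [set: 'I_3 * 'I_3] by exact: finite_finset.
have := @tychonoff nat (fun=> P) (fun=> setT) (fun=> @finite_compact P setT finP).
by congr compact; apply/seteqP.
Qed.

Lemma continuous_pair (T U V : topologicalType) (f : T -> U) (g : T -> V) :
  continuous f -> continuous g -> continuous (fun x => (f x, g x)).
Proof.
move=> cf cg x; apply: (@cvg_pair _ _ _ (nbhs x) (nbhs (f x)) (nbhs (g x))).
  exact: cf.
exact: cg.
Qed.

Lemma fst_continuous (U V : topologicalType) : continuous (@fst U V).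
Proof. by move=> [u v]; exact: cvg_fst. Qed.

Lemma snd_continuous (U V : topologicalType) : continuous (@snd U V).
Proof. by move=> [u v]; exact: cvg_snd. Qed.

Variable R : realType.

Lemma lin_continuous : continuous (@lin R).
Proof.
move=> A; apply: (@continuous_comp _ _ _ (set_val : Aff R -> _) fst).
  exact: initial_continuous.
exact: fst_continuous.
Qed.

Lemma trans_continuous : continuous (@trans R).
Proof.
move=> A; apply: (@continuous_comp _ _ _ (set_val : Aff R -> _) snd).
  exact: initial_continuous.
exact: snd_continuous.
Qed.

Lemma fst_aff_continuous : continuous (fun x : preconfig R => x.1.1).
Proof.
by move=> x; apply: (@continuous_comp _ _ _ fst fst); exact: fst_continuous.
Qed.

Lemma snd_aff_continuous : continuous (fun x : preconfig R => x.2.1).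
Proof.
move=> x; apply: (@continuous_comp _ _ _ snd fst); last exact: fst_continuous.
exact: snd_continuous.
Qed.

Lemma relscale_continuous : continuous (@relscale R).
Proof.
move=> x; apply: (@cvgM R[i] _ _ (nbhs_filter x)).
  apply: (@cvgV R[i] _ _ (nbhs_filter x)); first exact: lin_neq0.
  apply: (@cvg_comp _ _ _ _ (@lin R)); last exact: lin_continuous.
  exact: fst_aff_continuous.
apply: (@cvg_comp _ _ _ _ (@lin R)); last exact: lin_continuous.
exact: snd_aff_continuous.
Qed.

Lemma relshift_continuous : continuous (@relshift R).
Proof.
move=> x; apply: (@cvgM R[i] _ _ (nbhs_filter x)).
  apply: (@cvgV R[i] _ _ (nbhs_filter x)); first exact: lin_neq0.
  apply: (@cvg_comp _ _ _ _ (@lin R)); last exact: lin_continuous.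
  exact: fst_aff_continuous.
apply: (@cvgB _ (Cplane R) _ _ (nbhs_filter x)).
  apply: (@cvg_comp _ _ _ _ (@trans R)); last exact: trans_continuous.
  exact: snd_aff_continuous.
apply: (@cvg_comp _ _ _ _ (@trans R)); last exact: trans_continuous.
exact: fst_aff_continuous.
Qed.

Lemma rep_cls (x : preconfig R) : exists B, rep (cls x) = act B x.
Proof. by apply/clsP; rewrite cls_rep. Qed.

End Topology.

(** * The recurrent compact set *)

Section RecurrentSet.
Variable R : realType.
Implicit Types (x : preconfig R) (v : config R).

Definition closed_window x : Prop :=
  1 / 10 <= supn (relscale x) <= 21 / 20 /\ supn (relshift x) <= 101 / 200.

Definition open_window x : Prop :=
  1 / 10 < supn (relscale x) < 21 / 20 /\ supn (relshift x) < 101 / 200.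

Definition window : set (config R) := [set v | closed_window (rep v)].

Lemma window_cls x : window (cls x) <-> closed_window x.
Proof.
rewrite /window /= /closed_window; have [B ->] := rep_cls x.
by rewrite relscale_act relshift_act.
Qed.

Lemma open_window_open : open (open_window : set (preconfig R)).
Proof.
pose f x : R^o := supn (relscale x).
pose g x : R^o := supn (relshift x).
have fc : continuous f.
  move=> x; apply: (@continuous_comp _ _ _ _ (@supn R : Cplane R -> R^o)).
    exact: relscale_continuous.
  exact: supn_continuous.
have gc : continuous g.
  move=> x; apply: (@continuous_comp _ _ _ _ (@supn R : Cplane R -> R^o)).
    exact: relshift_continuous.
  exact: supn_continuous.
have -> : open_window =
    f @^-1` `]1 / 10, 21 / 20[ `&` g @^-1` [set y | y < 101 / 200].
  by apply/seteqP; split=> x /=; rewrite /open_window in_itv.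
by apply: openI; apply: open_comp.
Qed.

Lemma window_interior x : open_window x -> window° (cls x).
Proof.
move=> ox; rewrite /interior nbhsE /=.
exists [set v | open_window (rep v)]; last first.
  by move=> v [/andP[h1 h2] h3]; split; [rewrite !ltW|exact: ltW].
have rO y : open_window (rep (cls y)) <-> open_window y.
  have [B ->] := rep_cls y.
  by rewrite /open_window relscale_act relshift_act.
split; last exact/rO.
(* a set of classes is open when its preimage by the projection is *)
have := open_window_open; congr open.
by apply/seteqP; split=> y /rO.
Qed.

Lemma window_compact : compact window.
Proof.
pose K : set (Cplane R * Cplane R) :=
  ([set z | supn z <= 21 / 20] `&` [set z | 1 / 10 <= supn z]) `*`
  [set z | supn z <= 101 / 200].
have cK : compact K.
  apply: compact_setX; last exact: compact_supn_le.
  apply: compact_closedI; first exact: compact_supn_le.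
  apply: (@preimage_closed _ _ (@supn R : Cplane R -> R^o) [set y | 1 / 10 <= y]).
  - by move=> x _; exact: supn_continuous.
  - exact: closed_ge.
have KA : K `<=` [set p | p.1 != 0].
  move=> [z t] /= [[_ +] _]; apply: contraTneq => ->.
  by rewrite /supn /= normr0 maxxx -ltNge; lra.
have cA := compact_set_type KA cK.
(* the slice of the pairs whose first map is the identity meets every orbit *)
pose e (p : Aff R * (Sigma * Sigma)) : preconfig R :=
  ((aff1 R, p.2.1), (p.1, p.2.2)).
have scaleE p : relscale (e p) = lin p.1 by exact: relscale_id.
have shiftE p : relshift (e p) = trans p.1 by exact: relshift_id.
have -> : window =
    @cls R @` (e @` ((set_val @^-1` K : set (Aff R)) `*` setT)).
  apply/seteqP; split=> [v wv|v [x [[A [t t']] [[[hs1 hs2] ht] _] <-] <-]];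
    last first.
    apply/window_cls; rewrite /closed_window scaleE shiftE.
    by split=> //; apply/andP.
  pose x := rep v; pose B := affV x.1.1.
  have eE : e (affM B x.2.1, (x.1.2, x.2.2)) = act B x.
    by rewrite /e /act /= affVM.
  exists (act B x); last by rewrite -(cls_rep v); apply/esym/clsP; exists B.
  exists (affM B x.2.1, (x.1.2, x.2.2)) => //; split => //=.
  have := scaleE (affM B x.2.1, (x.1.2, x.2.2)).
  have := shiftE (affM B x.2.1, (x.1.2, x.2.2)).
  rewrite eE relscale_act relshift_act /= => tE sE.
  have [/andP[hs1 hs2] ht] := wv.
  have : K (lin (affM B x.2.1), trans (affM B x.2.1)).
    by rewrite -sE -tE; split.
  exact.
apply: continuous_compact.
  by apply: continuous_subspaceT; exact: pi_continuous.
apply: continuous_compact.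
  apply: continuous_subspaceT; apply: continuous_pair.
    apply: continuous_pair; first by move=> p; exact: cvg_cst.
    move=> p; apply: (@continuous_comp _ _ _ snd fst); last exact: fst_continuous.
    exact: snd_continuous.
  apply: continuous_pair; first exact: fst_continuous.
  by move=> p; apply: (@continuous_comp _ _ _ snd snd); exact: snd_continuous.
apply: compact_setX => //; rewrite -setXTT.
by apply: compact_setX; exact: compact_Sigma.
Qed.

End RecurrentSet.

Unset Implicit Arguments.

Theorem theoremC (R : realType) :
  exists delta : R, [/\ 0 < delta, delta < 1 &
    forall c1 : R,
      1 - delta < c1 -> c1 < (3 - 3 * delta) / (3 - delta) ->
      exists L : set (config R),
        recurrent_compact (1 - delta) c1 L /\
        (forall (a : P) (theta theta' : Sigma),
          theta 0%N = a -> theta' 0%N = a ->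
          L (cls ((aff1 R, theta), (aff1 R, theta'))))].
Proof.
exists (1 / 1000); split; [lra|lra|move=> c1 c1_gt c1_lt].
have c1_pos : 0 < c1 by lra.
have c1_lt1 : c1 < 1.
  by apply: lt_trans c1_lt _; rewrite ltr_pdivrMr; lra.
have c1_neq0 : c1 != 0 by rewrite gt_eqF.
have c0_gt0 : 0 < 1 - 1 / 1000 :> R by lra.
have kb : 3 <= 3 / c1 <= 1001 / 333.
  apply/andP; split; first by rewrite ler_pdivlMr//; lra.
  by rewrite ler_pdivrMr//; lra.
exists (@window R); split; [split|].
- exact: window_compact.
- move=> v; rewrite -(cls_rep v) => /window_cls[hs ht].
  have [w [w' [w0 w0' nz hs' ht']]] := recurrence c0_gt0 c1_neq0 kb hs ht.
  exists w, w'; split => //; first exact/compatible_cls.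
  by rewrite renorm_cls; apply: window_interior.
- move=> a th th' _ _; apply/window_cls.
  rewrite /closed_window relscale_id relshift_id lin1 trans1.
  by rewrite /supn /= normr0 normr1 maxxx max_l//; split; lra.
Qed.
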